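(* Let $S$ be a connected subset of $\mathbb{R}^k$ and let $(f,X)$ be an i.i.d. random iteration of $J$-monotone continuous maps on $S$ satisfying the $J$-splitting condition. Assume that there are a bounded set $B_0$ and an integer $N_0$ such that $f_\omega^{N_0}(S)\subset B_0$ for $\mathbb{P}$-almost every $\omega$. Then there exist constants $r<1$ and $m_0\ge 1$ and an integrable map $c\colon\Omega\to[0,\infty)$ such that for $\mathbb{P}$-almost every $\omega$ $$\operatorname{diam} f_\omega^n(S)\le c(\omega)\,r^n$$ for every $n\ge m_0$.
   Context: Setting. $(E,\nu)$ is a probability space; $X=\{X_n\}_{n\ge 0}$ is an i.i.d. sequence of $E$-valued random variables with common distribution $\nu$, defined on a probability space $(\Omega,\mathscr{F},\mathbb{P})$. Let $S\subset\mathbb{R}^k$, let $f\colon E\times S\to S$ be measurable, and write $f_\alpha(x)=f(\alpha,x)$. The pair $(f,X)$ is called an i.i.d. random iteration of maps; it is an i.i.d. random iteration of $J$-monotone continuous maps if every $f_\alpha\colon S\to S$ is continuous and $J$-monotone in the sense below. Write $$f_\omega^n(x)=f_{X_{n-1}(\omega)}\circ\cdots\circ f_{X_0(\omega)}(x).$$ Order. Fix $J\subset\{1,\dots,k\}$. For $x,y\in\mathbb{R}^k$ write $x<_J y$ iff $x_i<y_i$ for all $i\in J$ and $x_i>y_i$ for all $i\notin J$. For subsets $S_1,S_2\subset\mathbb{R}^k$ write $S_1<_J S_2$ if $x<_J y$ for every $x\in S_1$, $y\in S_2$. A map $g\colon S\to S$ is $J$-increasing if $x<_J y\Rightarrow g(x)<_J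 g(y)$, $J$-decreasing if $x<_J y\Rightarrow g(y)<_J g(x)$, and $J$-monotone if it is either $J$-increasing or $J$-decreasing. $J$-splitting condition. $(f,X)$ satisfies the $J$-splitting condition if there are $m\in\mathbb{N}$, $m\ge1$, and measurable subsets $A,B$ of $E^m$ with $\nu^m(A)>0$ and $\nu^m(B)>0$ such that for every $(\alpha_0,\dots,\alpha_{m-1})\in A$ and $(\beta_0,\dots,\beta_{m-1})\in B$, $$f_{\alpha_0}\circ\cdots\circ f_{\alpha_{m-1}}(S)<_J f_{\beta_0}\circ\cdots\circ f_{\beta_{m-1}}(S).$$ *)

(* Defs.v *)
From HB Require Import structures.
From mathcomp Require Import all_boot all_order all_algebra finmap.
From mathcomp Require Import all_classical all_reals all_analysis.

Set Implicit Arguments.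
Unset Strict Implicit.
Unset Printing Implicit Defensive.

Import Order.TTheory GRing.Theory Num.Theory.
Import numFieldNormedType.Exports.

Local Open Scope classical_set_scope.
Local Open Scope ring_scope.

Section order.
Context {R : realType} {k : nat}.
Implicit Types (J : {set 'I_k}) (x y : 'rV[R]_k) (S : set 'rV[R]_k).

Definition ltJ J x y : Prop :=
  forall i : 'I_k, if i \in J then x ord0 i < y ord0 i else y ord0 i < x ord0 i.

Definition set_ltJ J S1 S2 : Prop :=
  forall x y, S1 x -> S2 y -> ltJ J x y.

(* Self-maps of S are represented by maps g of the ambient space sending S to
   S; only the values of g on S matter. *)
Definition J_increasing J S (g : 'rV[R]_k -> 'rV[R]_k) : Prop :=
  forall x y, S x -> S y -> ltJ J x y -> ltJ J (g x) (g y).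

Definition J_decreasing J S (g : 'rV[R]_k -> 'rV[R]_k) : Prop :=
  forall x y, S x -> S y -> ltJ J x y -> ltJ J (g y) (g x).

Definition J_monotone J S (g : 'rV[R]_k -> 'rV[R]_k) : Prop :=
  J_increasing J S g \/ J_decreasing J S g.

End order.

Section diameter.
Context {R : realType} {k : nat}.

(* The library's norm on 'rV[R]_k is the sup norm, hence this definition. *)
Definition euclidean_dist (x y : 'rV[R]_k) : R :=
  Num.sqrt (\sum_(i < k) (x ord0 i - y ord0 i) ^+ 2).

(* The point 0 is adjoined so that the empty set has diameter 0, not -oo. *)
Definition diam (A : set 'rV[R]_k) : \bar R :=
  ereal_sup (0%E |` [set (euclidean_dist x y)%:E | x in A & y in A]).

End diameter.

Notation borelRV R k := (g_sigma_algebraType (@open 'rV[R]_k)).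

(* Measurability for the trace sigma-algebra on D. Unlike [measurable_fun D g],
   which holds vacuously when D is not measurable, this is meaningful for
   every D. *)
Definition trace_measurable_fun d d' (T : measurableType d)
    (U : measurableType d') (D : set T) (g : T -> U) : Prop :=
  forall Y : set U, measurable Y -> strace measurable D (g @^-1` Y `&` D).

Section power_probability.
Context d (E : measurableType d) (R : realType).

Definition tuple_cons n (p : E * n.-tuple E) : n.+1.-tuple E :=
  [tuple of p.1 :: p.2].

Lemma measurable_tuple_cons n :
  measurable_fun [set: E * n.-tuple E] (@tuple_cons n).
Proof. exact: measurable_cons. Qed.

HB.instance Definition _ n := isMeasurableFun.Build _ _ _ _
  (@tuple_cons n) (@measurable_tuple_cons n).

Fixpoint power_probability (nu : probability E R) (n : nat) :
    probability (n.-tuple E) R :=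
  if n is n'.+1
  then distribution (nu \x power_probability nu n')%E (@tuple_cons n')
  else dirac [tuple].

Lemma power_probabilityE (nu : probability E R) n (A : 'I_n -> set E) :
  (forall i, measurable (A i)) ->
  power_probability nu n [set t | forall i, A i (tnth t i)] =
  (\prod_(i < n) nu (A i))%E.
Proof.
elim: n A => [|n IHn] A mA /=.
  by rewrite big_ord0 diracE mem_set// => -[].
rewrite big_ord_recl /distribution /pushforward.
have -> : @tuple_cons n @^-1` [set t | forall i, A i (tnth t i)] =
    A ord0 `*` [set t | forall i, A (lift ord0 i) (tnth t i)].
  apply/seteqP; split=> -[x t] /=.
    move=> H; split=> [|i]; first exact: (H ord0).
    by move: (H (lift ord0 i)); rewrite tnthS.
  move=> [Ax H] i; case: (unliftP ord0 i) => [j|] -> //.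
  by rewrite tnthS; exact: H.
have mB : measurable [set t : n.-tuple E |
    forall i, A (lift ord0 i) (tnth t i)].
  have -> : [set t : n.-tuple E | forall i, A (lift ord0 i) (tnth t i)] =
      \bigcap_(i in [set: 'I_n])
        ((fun t : n.-tuple E => tnth t i) @^-1` A (lift ord0 i)).
    by apply/seteqP; split=> t /= H i => [_|]; exact: H.
  apply: fin_bigcap_measurable => [|i _]; first exact: finite_finset.
  by rewrite -[X in measurable X]setTI; exact: measurable_tnth.
rewrite product_measure1E//; congr (_ * _)%E.
by apply: (IHn (fun i => A (lift ord0 i))) => i; exact: mA.
Qed.

End power_probability.

Section iid.
Context d d' (Omega : measurableType d) (E : measurableType d') (R : realType).
Implicit Types (P : probability Omega R) (nu : probability E R).

Definition mutually_independent P (X : nat -> Omega -> E) : Prop :=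
  forall (I : {fset nat}) (A : nat -> set E), (forall i, measurable (A i)) ->
    P (\bigcap_(i in [set` I]) X i @^-1` A i) =
    (\prod_(i <- I) P (X i @^-1` A i))%E.

Definition iid P nu (X : nat -> {RV P >-> E}) : Prop :=
  mutually_independent P (fun n => X n) /\
  forall n (A : set E), measurable A -> distribution P (X n) A = nu A.

End iid.

Section iteration.
Context {E V : Type}.
Implicit Type f : E -> V -> V.

(* random_iterate f x n = f_{x (n-1)} \o ... \o f_{x 0} *)
Fixpoint random_iterate f (x : nat -> E) (n : nat) : V -> V :=
  if n is n'.+1 then f (x n') \o random_iterate f x n' else id.

(* word_map f [:: a_0; ...; a_{m-1}] = f_{a_0} \o ... \o f_{a_{m-1}} *)
Definition word_map f (a : seq E) (x : V) : V := foldr f x a.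

End iteration.

Definition J_splitting d (E : measurableType d) (R : realType) (k : nat)
    (nu : probability E R) (J : {set 'I_k}) (S : set 'rV[R]_k)
    (f : E -> 'rV[R]_k -> 'rV[R]_k) : Prop :=
  exists (m : nat) (A B : set (m.-tuple E)),
    [/\ (1 <= m)%N,
        measurable A /\ measurable B,
        (0 < power_probability nu m A)%E,
        (0 < power_probability nu m B)%E &
        forall a b : m.-tuple E, A a -> B b ->
          set_ltJ J (word_map f a @` S) (word_map f b @` S)].

Definition J_monotone_iteration d (E : measurableType d) (R : realType)
    (k : nat) (J : {set 'I_k}) (S : set 'rV[R]_k)
    (f : E -> 'rV[R]_k -> 'rV[R]_k) : Prop :=
  [/\ forall a x, S x -> S (f a x),
      trace_measurable_fun ([set: E] `*` S : set (E * borelRV R k))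
        (fun p => f p.1 p.2 : borelRV R k),
      forall a, {within S, continuous (f a)} &
      forall a, J_monotone J S (f a)].

(* Main.v *)
Require Import Defs.
From HB Require Import structures.
From mathcomp Require Import all_boot all_order all_algebra finmap.
From mathcomp Require Import all_classical all_reals all_analysis.
From mathcomp Require Import measurable_realfun.

Set Implicit Arguments.
Unset Strict Implicit.
Unset Printing Implicit Defensive.

Import Order.TTheory GRing.Theory Num.Theory.
Import numFieldNormedType.Exports.

Local Open Scope classical_set_scope.
Local Open Scope ring_scope.

(** The proof estimates, coordinate by coordinate, the expected length of the
    image of S, using that this length is an integral over the line.

    For a word w and a coordinate s, let shadow s w be the open interval of
    those x that lie strictly between the s-th coordinates of two points of
    the image w(S). Its Lebesgue measure is the oscillation of the s-th
    coordinate on w(S), so the diameter of w(S) is at most the sum over s of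
    these lengths ([diam_le_shadow]). By Tonelli, the expected length of the
    shadow of the random word is the integral over x of the probability that
    x lies in the shadow ([expected_shadow_length]).

    This probability decays geometrically, uniformly in x. Let A and B be the
    two sets of words of length m given by the splitting condition. If a is in
    A and b is in B, then a(S) and b(S) are ordered, and a J-monotone prefix c
    preserves or reverses that order; hence ca(S) and cb(S) have disjoint
    shadows. So for every prefix c, either no suffix in A or no suffix in B
    keeps x in the shadow, and the suffixes that do have measure at most some
    lam < 1 that depends on neither x nor c ([splitting_contraction]). Since
    shadows shrink when a word is extended on its inner side, integrating over
    the prefix gives the bound lam for each block of m letters
    ([hereditary_geometric]).

    Extending a word on the inner side is the reverse of what the iteration
    does, but the iterate at time n is the map of the word X_{n-1}, ..., X_0,
    whose law is the power of nu ([past_law]), and only its law matters for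
    the expectation. Because the iterates eventually stay in a bounded set,
    the integral over x runs over a fixed bounded interval, and the expected
    length at time n is at most a constant times lam ^ (n / m).

    Finally, with r a 2m-th root of lam, the expected lengths are of order
    r ^ (2n), so the sum over n of the lengths divided by r ^ n is integrable;
    this sum is the random constant c ([ae_geometric_bound]). *)

(** * Measurability and density in Euclidean space *)

(** D itself need not be measurable: the preimage of Y under F is the trace on
    D of a measurable set M, and a map with values in D cannot tell the trace
    from M. *)
Lemma trace_measurable_comp d d1 d2 (T : measurableType d)
    (U : measurableType d1) (V : measurableType d2) (D : set U)
    (F : U -> V) (H : T -> U) :
  measurable_fun setT H -> (forall t, D (H t)) ->
  trace_measurable_fun D F -> measurable_fun setT (F \o H).
Proof.
move=> mH DH mF _ Y mY; rewrite setTI.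
have [M mM MD] := mF Y mY.
rewrite (_ : _ @^-1` Y = H @^-1` M); first by
  rewrite -[X in measurable X]setTI; exact: mH.
apply/seteqP; split=> t /= Ht.
  by have : (F @^-1` Y `&` D) (H t) by []; rewrite -MD => -[].
by have : (M `&` D) (H t) by []; rewrite MD => -[].
Qed.

Lemma measurable_coord (R : realType) k (s : 'I_k) :
  measurable_fun [set: borelRV R k] (fun y : borelRV R k => y ord0 s : R).
Proof.
apply: (measurability _ (RGenOInfty.measurableE R)) => //.
move=> _ [_ [a ->] <-]; rewrite setTI; apply: sub_sigma_algebra.
apply: open_comp; last exact: interval_open.
by move=> y _; exact: coord_continuous.
Qed.

Lemma enumerate_family (T : countType) (V : Type) (P : V -> Prop) (h : T -> V) :
  (forall p, P (h p)) -> (exists x, P x) ->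
  exists d : nat -> V, (forall i, P (d i)) /\ forall p, exists i, d i = h p.
Proof.
move=> Ph [x0 Px0].
exists (fun i => if choice.unpickle i is Some p then h p else x0); split.
  by move=> i; case: choice.unpickle.
by move=> p; exists (choice.pickle p); rewrite choice.pickleK.
Qed.

Lemma rational_ball (R : realType) k (u : 'rV[R]_k) (n : nat) :
  exists q : seq rat, ball (\row_(s < k) ratr q`_s : 'rV[R]_k) n.+1%:R^-1 u.
Proof.
have /choice[q qP] : forall s : 'I_k, exists q : rat,
    `|u ord0 s - ratr q| < n.+1%:R^-1.
  move=> s; have [|q] := @rat_in_itvoo R
      (u ord0 s - n.+1%:R^-1) (u ord0 s + n.+1%:R^-1).
    by rewrite ltrBlDr -addrA ltrDl addr_gt0// invr_gt0.
  by rewrite in_itv/= => uq; exists q; rewrite distrC ltr_distl.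
exists [seq q s | s <- enum 'I_k]; split=> [|i j]; first by rewrite invr_gt0.
rewrite mxE ord1 (nth_map j) ?size_enum_ord// nth_ord_enum /ball/= distrC.
exact: qP.
Qed.

(** Any subset of a separable metric space is separable: pick one point of S in
    each ball with rational centre and radius 1/n that meets S. *)
Lemma dense_sequence (R : realType) k (S : set 'rV[R]_k) :
  S !=set0 -> exists d : nat -> 'rV[R]_k, (forall i, S (d i)) /\
    forall u e, S u -> 0 < e -> exists i, ball u e (d i).
Proof.
move=> S0.
pose c (p : seq rat * nat) : 'rV[R]_k := \row_(s < k) ratr p.1`_s.
pose r (p : seq rat * nat) : R := p.2.+1%:R^-1.
have /choice[h hP] : forall p, exists y, S y /\
    ((exists2 y, S y & ball (c p) (r p) y) -> ball (c p) (r p) y).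
  move=> p.
  have [[y Sy py]|np] := pselect (exists2 y, S y & ball (c p) (r p) y).
    by exists y.
  by have [x0 Sx0] := S0; exists x0.
have [d [Sd dh]] := enumerate_family (fun p => (hP p).1) S0.
exists d; split=> // u e Su e0.
have e20 : 0 < e / 2 by rewrite divr_gt0.
pose n := Num.truncn (e / 2)^-1.
have ne : n.+1%:R^-1 < e / 2.
  by rewrite invf_plt ?posrE// truncnS_gt.
have [q qu] := rational_ball u n.
have [i di] := dh (q, n).
exists i; rewrite di.
have pd : ball (c (q, n)) (r (q, n)) (h (q, n)).
  by apply: (hP (q, n)).2; exists u.
rewrite (splitr e); apply: (@ball_triangle _ _ (c (q, n))).
  by apply: ball_sym; apply: le_ball qu; exact: ltW.
by apply: le_ball pd; exact: ltW.
Qed.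

(** * Word maps and their shadows *)

Section words.
Context (R : realType) (k : nat) (dE : measure_display) (E : measurableType dE).
Context (J : {set 'I_k}) (S : set 'rV[R]_k) (f : E -> 'rV[R]_k -> 'rV[R]_k).

(** The interior of the convex hull of the s-th projection of w(S). Strict
    inequalities make it detectable from a countable dense subset of S. *)
Definition shadow (s : 'I_k) (w : seq E) : set R :=
  [set x | exists u v, [/\ S u, S v, word_map f w u ord0 s < x &
                           x < word_map f w v ord0 s]].

Hypothesis fJ : J_monotone_iteration J S f.

Lemma word_map_cat w1 w2 u :
  word_map f (w1 ++ w2) u = word_map f w1 (word_map f w2 u).
Proof. exact: foldr_cat. Qed.

Lemma word_map_self w u : S u -> S (word_map f w u).
Proof. by case: fJ => fS _ _ _ Su; elim: w => //= a w; exact: fS. Qed.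

(** Either kind of monotonicity is allowed at each letter: orientations multiply
    like signs. *)
Lemma word_map_monotone w : J_monotone J S (word_map f w).
Proof.
case: fJ => fS _ _ fm; elim: w => [|a w IHw]; first by left.
have wS := word_map_self w.
case: (fm a) IHw => fa [] fw; [left|right|right|left] => x y Sx Sy xy /=.
- by apply: fa => //; auto.
- by apply: fa => //; auto.
- by apply: fa => //; auto.
- by apply: fa => //; auto.
Qed.

Lemma word_map_continuous w : {within S, continuous (word_map f w)}.
Proof.
case: fJ => fS _ fc _; elim: w => [|a w IHw].
  by apply: continuous_subspaceT => x; exact: cvg_id.
apply/subspace_continuousP => x Sx.
move/subspace_continuousP : (fc a) => /(_ _ (word_map_self w Sx)) ca.
move/subspace_continuousP : IHw => /(_ x Sx) cw V /ca Va.
have := cw _ Va.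
apply: (@filterS _ (nbhs x)) => y /= Vy Sy.
by apply: Vy => //; exact: word_map_self.
Qed.

(** The letters of c are fixed and those of t vary, so that prefixes can be
    frozen one letter at a time. *)
Lemma measurable_word_map c n u : S u ->
  measurable_fun setT
    (fun t : n.-tuple E => word_map f (c ++ t) u : borelRV R k).
Proof.
case: fJ => fS mf _ _ Su.
have step d (T : measurableType d) (a : T -> E) (h : T -> borelRV R k) :
    measurable_fun setT a -> measurable_fun setT h -> (forall t, S (h t)) ->
    measurable_fun setT (fun t => f (a t) (h t) : borelRV R k).
  move=> ma mh Sh.
  apply: (@trace_measurable_comp _ _ _ _ _ _ _ _ (fun t => (a t, h t)) _ _ mf).
    exact: measurable_fun_pair.
  by move=> t; split => //=.
elim: c => [|a c IHc] /=; last first.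
  by apply: step => // t; exact: word_map_self.
elim: n => [|n IHn].
  apply: (eq_measurable_fun (cst (u : borelRV R k))) => // t _.
  by rewrite tuple0.
apply: (eq_measurable_fun (fun t : n.+1.-tuple E =>
    f (tnth t ord0) (word_map f (behead_tuple t) u) : borelRV R k)).
  by move=> t _; rewrite (tuple_eta t).
apply: (@step _ _ (fun t : n.+1.-tuple E => tnth t ord0)).
- exact: measurable_tnth.
- apply: (@measurableT_comp _ _ _ _ _ _
    (fun t : n.-tuple E => word_map f t u : borelRV R k)).
    exact: IHn.
  exact: measurable_behead.
- by move=> t; exact: word_map_self.
Qed.

Lemma shadow_cat s c w : shadow s (c ++ w) `<=` shadow s c.
Proof.
move=> x [u [v []]]; rewrite !word_map_cat => Su Sv ux xv.
by exists (word_map f w u), (word_map f w v); split=> //; exact: word_map_self.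
Qed.

(** S may fail to be measurable, but continuity of the word maps lets the two
    witnesses in S range over a dense sequence, which turns the shadow into a
    countable union. *)
Lemma measurable_shadow s c n :
  measurable [set p : n.-tuple E * R | shadow s (c ++ p.1) p.2].
Proof.
have [S0|/set0P[x0 Sx0]] := eqVneq S set0.
  rewrite (_ : [set _ | _] = set0)//.
  by apply/seteqP; split=> // p [u [v []]]; rewrite S0.
have [|d [Sd dd]] := @dense_sequence R k S; first by exists x0.
pose F i (p : n.-tuple E * R) : R := word_map f (c ++ p.1) (d i) ord0 s.
have mF i : measurable_fun setT (F i).
  apply: (@measurableT_comp _ _ _ _ _ _ (fun y : borelRV R k => y ord0 s)).
    exact: measurable_coord.
  apply: (@measurableT_comp _ _ _ _ _ _
    (fun t : n.-tuple E => word_map f (c ++ t) (d i) : borelRV R k)) => //.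
  exact: measurable_word_map.
have mlt (g h : n.-tuple E * R -> R) : measurable_fun setT g ->
    measurable_fun setT h -> measurable [set p | g p < h p].
  move=> mg mh; have /(_ measurableT [set true]) := measurable_fun_ltr mg mh.
  by rewrite setTI; exact.
rewrite (_ : [set _ | _] =
    (\bigcup_i [set p | F i p < p.2]) `&` (\bigcup_i [set p | p.2 < F i p])).
  by apply: measurableI; apply: bigcupT_measurable => i; apply: mlt.
have near_d u (U : set R) (p : n.-tuple E * R) : S u -> open U ->
    U (word_map f (c ++ p.1) u ord0 s) -> exists i, U (F i p).
  move=> Su oU Uu.
  move/subspace_continuousP : (@word_map_continuous (c ++ p.1)) => /(_ u Su) cw.
  have : nbhs (word_map f (c ++ p.1) u) [set y : 'rV[R]_k | U (y ord0 s)].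
    apply: (@coord_continuous R 1 k ord0 s _ U).
    exact: open_nbhs_nbhs.
  move=> /cw /(iffLR (@nbhs_ballP R _ u _))[e e0 He].
  by have [i ui] := dd u e Su e0; exists i; exact: (He _ ui (Sd i)).
apply/seteqP; split=> p /=.
  move=> [u [v [Su Sv ux xv]]]; split.
    by have [i Hi] := near_d u _ p Su (@open_lt R p.2) ux; exists i.
  by have [i Hi] := near_d v _ p Sv (@open_gt R p.2) xv; exists i.
move=> [[i _ ix] [j _ xj]].
by exists (d i), (d j); split.
Qed.

End words.

(** * Geometric decay for hereditary events *)

Section hereditary.
Context (R : realType) (dE : measure_display) (E : measurableType dE).
Context (nu : probability E R) (Q : seq E -> Prop).
Hypothesis mQ : forall c n, measurable [set t : n.-tuple E | Q (c ++ t)].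
Hypothesis hQ : forall c w, Q (c ++ w) -> Q c.

(* The probability that the word c, extended by n independent letters on its
   inner side, still satisfies Q. *)
Let p n c := power_probability nu n [set t : n.-tuple E | Q (c ++ t)].

(** Conditioning on the first free letter moves it to the end of the prefix, so
    that induction on the number of letters never splits a tuple. *)
Lemma power_probability_cons n c :
  p n.+1 c = (\int[nu]_e p n (rcons c e))%E.
Proof.
rewrite /p/= /distribution /pushforward.
apply: eq_integral => e _ /=; congr (power_probability nu n _).
apply/seteqP; split=> t; rewrite /xsection/= inE/= -cat_rcons//.
Qed.

Lemma measurable_power_probability_rcons n c :
  measurable_fun setT (fun e => p n (rcons c e)).
Proof.
apply: (eq_measurable_fun (power_probability nu n \o
    xsection [set q : E * n.-tuple E | Q (c ++ q.1 :: q.2)])).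
  move=> e _ /=; congr (power_probability nu n _).
  by apply/seteqP; split=> t; rewrite /xsection/= inE/= -cat_rcons.
apply: measurable_fun_xsection.
rewrite -[X in measurable X]setTI.
have := @measurable_tuple_cons _ E n measurableT _ (@mQ c n.+1).
exact.
Qed.

(** A word of length l that fails Q cannot be extended to one satisfying Q, and
    one that satisfies Q survives m more letters with probability at most
    lam. *)
Lemma hereditary_contraction m (lam : R) : 0 <= lam ->
  (forall c, p m c <= lam%:E)%E ->
  forall l c, (p (l + m) c <= lam%:E * p l c)%E.
Proof.
move=> lam0 H; elim=> [|l IHl] c.
  rewrite add0n; have [Qc|nQc] := pselect (Q c).
    have -> : p 0 c = 1%E by rewrite /p/= diracE mem_set//= cats0.
    by rewrite mule1; exact: H.
  have -> : p m c = 0%E.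
    rewrite -(measure0 (power_probability nu m));
      congr (power_probability nu m _).
    by apply/seteqP; split=> // t /hQ.
  by rewrite mule_ge0.
rewrite addSn !power_probability_cons -ge0_integralZl//; last first.
  exact: measurable_power_probability_rcons.
apply: ge0_le_integral => //.
- exact: measurable_power_probability_rcons.
- by apply: measurable_funeM; exact: measurable_power_probability_rcons.
Qed.

Let p_le1 n c : (p n c <= 1)%E.
Proof. by apply: probability_le1; exact: mQ. Qed.

Lemma hereditary_geometric m (lam : R) : 0 <= lam ->
  (forall c, p m c <= lam%:E)%E ->
  forall n, (p n [::] <= (lam ^+ (n %/ m))%:E)%E.
Proof.
move=> lam0 H n; rewrite {1}(divn_eq n m) addnC.
elim: (n %/ m)%N => [|j IHj].
  by rewrite mul0n addn0 expr0; exact: p_le1.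
rewrite mulSn addnCA addnC (le_trans (hereditary_contraction lam0 H _ _))//.
by rewrite exprS EFinM lee_wpmul2l// lee_fin.
Qed.

Lemma hereditary_nonincreasing l n : (l <= n)%N -> (p n [::] <= p l [::])%E.
Proof.
move=> /subnKC <-; rewrite -[leRHS]mul1e.
by apply: hereditary_contraction => // c; exact: p_le1.
Qed.

End hereditary.

(** * The splitting condition bounds the survival probability *)

Section splitting.
Context (R : realType) (k : nat) (dE : measure_display) (E : measurableType dE).
Context (nu : probability E R).
Context (J : {set 'I_k}) (S : set 'rV[R]_k) (f : E -> 'rV[R]_k -> 'rV[R]_k).
Hypothesis fJ : J_monotone_iteration J S f.

(** If x were in both shadows, each of the images ca(S) and cb(S) would have
    points on both sides of x, whereas their s-th projections are separated,
    in an order that depends on s and on the orientation of c. *)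
Lemma shadow_ordered_disjoint s c a b x :
  set_ltJ J (word_map f a @` S) (word_map f b @` S) ->
  shadow S f s (c ++ a) x -> shadow S f s (c ++ b) x -> False.
Proof.
move=> ab [u [v []]]; rewrite !word_map_cat => Su Sv ux xv.
move=> [u' [v' []]]; rewrite !word_map_cat => Su' Sv' ux' xv'.
have wS w y : S y -> S (word_map f w y) by exact: (word_map_self fJ).
have lab y z : S y -> S z -> ltJ J (word_map f a y) (word_map f b z).
  by move=> Sy Sz; apply: ab; [exists y|exists z].
have no (y z : R) : y < x -> x < z -> z < y -> False.
  by move=> yx xz zy; have := lt_trans (lt_trans zy yx) xz; rewrite ltxx.
case: (word_map_monotone fJ c) => cm.
- have := cm _ _ (wS _ _ Sv) (wS _ _ Su') (lab _ _ Sv Su') s.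
  have := cm _ _ (wS _ _ Su) (wS _ _ Sv') (lab _ _ Su Sv') s.
  by case: ifPn => _ h1 h2; [apply: no ux' xv h2|apply: no ux xv' h1].
- have := cm _ _ (wS _ _ Sv) (wS _ _ Su') (lab _ _ Sv Su') s.
  have := cm _ _ (wS _ _ Su) (wS _ _ Sv') (lab _ _ Su Sv') s.
  by case: ifPn => _ h1 h2; [apply: no ux xv' h1|apply: no ux' xv h2].
Qed.

Lemma measurable_shadow_tuple s c n x :
  measurable [set t : n.-tuple E | shadow S f s (c ++ t) x].
Proof.
have := @measurable_ysection _ _ _ _ _ x (measurable_shadow fJ s c (n:=n)).
by congr measurable; apply/seteqP; split=> t; rewrite /ysection/= inE.
Qed.

(** By disjointness of shadows, the suffixes that keep x in the shadow avoid A
    or avoid B, so their measure is at most one minus the smaller of the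
    measures of A and B. The maximum with 1/2 makes lam positive, for the sake
    of its roots and inverse. *)
Lemma splitting_contraction : J_splitting nu J S f ->
  exists (m : nat) (lam : R), [/\ (0 < m)%N, 0 < lam, lam < 1 &
    forall s c x, (power_probability nu m
      [set t : m.-tuple E | shadow S f s (c ++ t) x] <= lam%:E)%E].
Proof.
move=> [m [A [B [m1 [mA mB] A0 B0 AB]]]].
set P := power_probability nu m in A0 B0 *.
have fA : P A \is a fin_num by exact: fin_num_measure.
have fB : P B \is a fin_num by exact: fin_num_measure.
have a0 : 0 < fine (P A) by rewrite -lte_fin fineK.
have b0 : 0 < fine (P B) by rewrite -lte_fin fineK.
exists m, (Num.max 2^-1 (Num.max (1 - fine (P A)) (1 - fine (P B)))).
split => //.
- by rewrite lt_max invr_gt0 ltr0n.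
- by rewrite !gt_max !gtrBl a0 b0 invf_lt1// ltr1n.
move=> s c x; set Q := [set t : m.-tuple E | _].
have mQ : measurable Q by exact: measurable_shadow_tuple.
have small (D : set (m.-tuple E)) : measurable D -> P D \is a fin_num ->
    (forall t, D t -> Q t -> False) -> (P Q <= (1 - fine (P D))%:E)%E.
  move=> mD fD DQ; rewrite EFinB fineK// -probability_setC//.
  apply: le_measure; rewrite ?inE//; first exact: measurableC.
  by move=> t Qt Dt; exact: (DQ t).
have [[a [Aa Qa]]|nA] := pselect (exists a, A a /\ Q a).
  apply: le_trans (small B mB fB _) _.
    by move=> b Bb Qb; apply: (shadow_ordered_disjoint (AB a b Aa Bb) Qa Qb).
  by rewrite lee_fin !le_max lexx !orbT.
apply: le_trans (small A mA fA _) _.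
  by move=> a Aa Qa; apply: nA; exists a.
by rewrite lee_fin !le_max lexx !orbT.
Qed.

End splitting.

(** * The law of the reversed past *)

Section past.
Context (R : realType) (dE : measure_display) (E : measurableType dE).
Context (dO : measure_display) (Omega : measurableType dO).

(** The word X_{n-1}, ..., X_0: most recent letter first, since the leftmost
    letter of a word acts last. *)
Definition past (X : nat -> Omega -> E) n (w : Omega) : n.-tuple E :=
  [tuple X (rev_ord i) w | i < n].

Lemma pastS X n w : past X n.+1 w = [tuple of X n w :: past X n w].
Proof.
apply: eq_from_tnth => i; rewrite tnth_mktuple.
case: (unliftP ord0 i) => [j|] ->; rewrite /= ?tnthS ?tnth_mktuple.
  by congr (X _ w); rewrite /= /bump leq0n add1n subSS.
by rewrite (tnth_nth (X n w))/= subSS subn0.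
Qed.

Lemma random_iterate_past (V : Type) (f : E -> V -> V) X n w :
  random_iterate f (X ^~ w) n =1 word_map f (past X n w).
Proof.
by elim: n => [|n IHn] x; [rewrite [past _ _ _]tuple0|rewrite pastS/= IHn].
Qed.

Context (P : probability Omega R) (nu : probability E R).
Context (X : nat -> {RV P >-> E}).

Lemma measurable_past n : measurable_fun setT (past X n).
Proof.
apply/measurable_fun_tnthP => i.
apply: (eq_measurable_fun (X (rev_ord i))) => // w _.
by rewrite /= tnth_mktuple.
Qed.

HB.instance Definition _ n := isMeasurableFun.Build _ _ _ _
  (past X n) (@measurable_past n).

Lemma measurable_tuple_box n (A : 'I_n -> set E) :
  (forall i, measurable (A i)) ->
  measurable [set t : n.-tuple E | forall i, A i (tnth t i)].
Proof.
move=> mA.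
have -> : [set t : n.-tuple E | forall i, A i (tnth t i)] =
    \bigcap_(i in [set: 'I_n]) ((fun t : n.-tuple E => tnth t i) @^-1` A i).
  by apply/seteqP; split=> t /= H i => [_|]; exact: H.
apply: fin_bigcap_measurable => [|i _]; first exact: finite_finset.
by rewrite -[X in measurable X]setTI; exact: measurable_tnth.
Qed.

(** The two measures agree on boxes, by independence of the letters, and
    boxes are a pi-system generating the product sigma-algebra. *)
Lemma past_law n (A : set (n.-tuple E)) : iid nu X -> measurable A ->
  P (past X n @^-1` A) = power_probability nu n A.
Proof.
move=> [indep law] mA.
pose G := [set B : set (n.-tuple E) | exists2 C : 'I_n -> set E,
  (forall i, measurable (C i)) & B = [set t | forall i, C i (tnth t i)]].
have GT : G setT by exists (fun=> setT) => //; apply/seteqP; split.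
suff : distribution P (past X n) A = power_probability nu n A by [].
apply: (@measure_unique _ _ _ G (fun=> setT)) => //.
- apply/seteqP; split.
    apply: smallest_sub; first exact: smallest_sigma_algebra.
    move=> B /=; rewrite -bigcup_seq/= => -[i _ [C mC <-]].
    apply: sub_sigma_algebra.
    exists (fun j => if j == i then C else setT); first by move=> j; case: ifP.
    apply/seteqP; split=> t /=; first by move=> [_ Ct] j; case: eqP => // ->.
    by move=> /(_ i); rewrite eqxx.
  apply: smallest_sub; first exact: sigma_algebra_measurable.
  by move=> _ [C mC ->]; exact: measurable_tuple_box.
- move=> _ _ [C mC ->] [D mD ->]; exists (fun i => C i `&` D i).
    by move=> i; exact: measurableI.
  apply/seteqP; split=> t /=; first by move=> [Ct Dt] i; split.
  by move=> H; split=> i; case: (H i).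
- by apply/seteqP; split=> // t _; exists 0%N.
- move=> _ [C mC ->]; apply: etrans (esym (power_probabilityE nu mC)).
  (* Independence is stated for families indexed by nat: the box is extended
     by setT outside the first n indices. *)
  pose D j := if insub j is Some i then C (rev_ord i) else setT.
  have DE (i : 'I_n) : D (rev_ord i) = C i by rewrite /D valK rev_ordK.
  have mD j : measurable (D j) by rewrite /D; case: insub.
  pose I := [fset (rev_ord i : nat) | i in 'I_n]%fset.
  have := indep I D mD.
  rewrite big_imfset /=; last first.
    by move=> i j _ _ ij; apply: rev_ord_inj; exact: val_inj.
  rewrite big_enum /= => PD.
  have -> : (\prod_(i < n) nu (C i) =
      \prod_(i < n) P (X (rev_ord i) @^-1` D (rev_ord i)))%E.
    by apply: eq_bigr => i _; rewrite DE -(law (rev_ord i)).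
  rewrite -PD; congr (P _); apply/seteqP; split=> w /=.
    move=> H j; rewrite /= => /imfsetP[i _ ->].
    by have := H i; rewrite tnth_mktuple DE.
  move=> H i; rewrite tnth_mktuple -DE; apply: H.
  by apply/imfsetP; exists i.
- by move=> _; rewrite (le_lt_trans (probability_le1 _ _))// ltry.
Qed.

End past.

(** * From summable expectations to an almost sure rate *)

Section summable_rate.
Context (R : realType) (dO : measure_display) (Omega : measurableType dO).
Context (P : probability Omega R).

Lemma nneseries_geometric_lty (K r : R) : 0 <= K -> 0 < r -> r < 1 ->
  (\sum_(0 <= n <oo) (K * r ^+ n)%:E < +oo)%E.
Proof.
move=> K0 r0 r1; apply: (@le_lt_trans _ _ (K / (1 - r))%:E); last exact: ltry.
apply: lime_le.
  apply: is_cvg_nneseries => n _ _.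
  by rewrite lee_fin mulr_ge0// exprn_ge0// ltW.
apply: nearW => n; rewrite sumEFin lee_fin.
by apply: (geometric_le_lim n K0 r0); rewrite ger0_norm// ltW.
Qed.

(** The constant is the sum of r ^- n times L n, finite almost everywhere
    because its integral is dominated by a geometric series: one factor r ^ n
    of the hypothesis pays for the rate, the other for summability. *)
Lemma ae_geometric_bound (L : nat -> Omega -> \bar R) (K r : R) :
  0 <= K -> 0 < r -> r < 1 ->
  (forall n w, 0 <= L n w)%E -> (forall n, measurable_fun setT (L n)) ->
  (forall n, \int[P]_w L n w <= (K * (r ^+ n * r ^+ n))%:E)%E ->
  exists c : Omega -> R, [/\ forall w, 0 <= c w,
    P.-integrable [set: Omega] (EFin \o c) &
    {ae P, forall w, forall n, (L n w <= (c w * r ^+ n)%:E)%E}].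
Proof.
move=> K0 r0 r1 L0 mL IL.
have rn0 n : 0 < r ^+ n by exact: exprn_gt0.
pose F n w : \bar R := ((r ^- n)%:E * L n w)%E.
have F0 n w : (0 <= F n w)%E by rewrite mule_ge0// lee_fin invr_ge0 ltW.
have mF n : measurable_fun setT (F n) by exact: measurable_funeM.
pose C w : \bar R := (\sum_(0 <= n <oo) F n w)%E.
have C0 w : (0 <= C w)%E by apply: nneseries_ge0 => n _ _; exact: F0.
have mC : measurable_fun setT C.
  by apply: ge0_emeasurable_sum => // n w _ _; exact: F0.
have IC : (\int[P]_w C w < +oo)%E.
  rewrite integral_nneseries//.
  apply: le_lt_trans (nneseries_geometric_lty K0 r0 r1).
  apply: lee_nneseries => n *; first by apply: integral_ge0 => w _; exact: F0.
  rewrite ge0_integralZl//; last by rewrite lee_fin invr_ge0 ltW.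
  have -> : (K * r ^+ n)%:E = ((r ^- n)%:E * (K * (r ^+ n * r ^+ n))%:E)%E.
    by rewrite -EFinM mulrCA mulKf// gt_eqF.
  by rewrite lee_wpmul2l// lee_fin invr_ge0 ltW.
have iC : P.-integrable setT C.
  apply/integrableP; split=> //.
  by under eq_integral do rewrite gee0_abs//.
have mc : measurable_fun setT (fine \o C).
  by apply: measurableT_comp mC; exact: fine_measurable.
exists (fine \o C); split.
- by move=> w; rewrite fine_ge0.
- apply: (le_integrable _ _ _ iC) => //; first exact/measurable_EFinP.
  move=> w _ /=; rewrite ger0_norm ?fine_ge0// gee0_abs//.
  by case: (C w) (C0 w) => //= *; exact: leey.
- have := integrable_ae measurableT iC.
  apply: filterS => w /(_ I) Cw n.
  have FC : (F n w <= C w)%E.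
    apply: le_trans (@nneseries_lim_ge _ _ xpredT 0 n.+1 _).
      by rewrite big_nat_recr//= leeDr// sume_ge0.
    by move=> *; exact: F0.
  rewrite EFinM fineK// muleC.
  rewrite -[leLHS]mul1e -(@divff _ (r ^+ n)) ?gt_eqF// EFinM -muleA.
  by rewrite lee_wpmul2l// lee_fin ltW.
Qed.

(** With r a 2m-th root of lam, rounding n / m down to an integer costs at
    most one factor lam. *)
Lemma geometric_rate (lam : R) m : (0 < m)%N -> 0 < lam -> lam < 1 ->
  exists r, [/\ 0 < r, r < 1 &
    forall n, lam ^+ (n %/ m) <= lam^-1 * (r ^+ n * r ^+ n)].
Proof.
move=> m0 lam0 lam1; pose r := lam `^ (2 * m)%:R^-1.
have m20 : (0 < 2 * m)%N by rewrite muln_gt0.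
have rm : r ^+ (2 * m) = lam.
  rewrite -powR_mulrn ?powR_ge0// -powRrM mulVf ?powRr1 ?(ltW lam0)//.
  by rewrite pnatr_eq0 -lt0n.
have r0 : 0 < r by exact: powR_gt0.
have r1 : r < 1.
  rewrite ltNge; apply/negP => r1.
  by have := exprn_ege1 (2 * m) r1; rewrite rm leNgt lam1.
exists r; split=> // n.
rewrite mulrC ler_pdivlMr// -exprSr -exprD -{1}rm -exprM.
apply: ler_wiXn2l; rewrite ?ltW//.
rewrite addnn -mul2n -mulnA leq_mul2l /= mulnC; apply: ltnW; exact: ltn_ceil.
Qed.

End summable_rate.

(** * Diameter and shadows *)

Section diameter.
Context (R : realType) (k : nat) (dE : measure_display) (E : measurableType dE).
Context (J : {set 'I_k}) (S : set 'rV[R]_k) (f : E -> 'rV[R]_k -> 'rV[R]_k).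
Hypothesis fJ : J_monotone_iteration J S f.

Lemma euclidean_dist_le_sum (x y : 'rV[R]_k) :
  euclidean_dist x y <= \sum_(s < k) `|x ord0 s - y ord0 s|.
Proof.
have step (z p q : R) : 0 <= p -> q <= p ^+ 2 -> z ^+ 2 + q <= (`|z| + p) ^+ 2.
  move=> p0 qp; rewrite sqrrD real_normK ?num_real// -addrA lerD2l.
  by rewrite (le_trans qp)// lerDr mulrn_wge0// mulr_ge0.
rewrite /euclidean_dist.
set b := \sum_(s < k) `|_|; set a := \sum_(s < k) _.
suff [ab b0] : a <= b ^+ 2 /\ 0 <= b.
  by rewrite -(ger0_norm b0) -sqrtr_sqr ler_wsqrtr.
rewrite /a /b; elim/big_rec2: _ => [|s p q _ [qp p0]]; first by rewrite expr0n.
by split; [exact: step|rewrite addr_ge0].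
Qed.

Lemma measurable_shadow_word s w : measurable (shadow S f s w).
Proof.
have := @measurable_xsection _ _ _ _ _ ([tuple] : 0.-tuple E)
  (measurable_shadow fJ s w (n:=0)).
by congr measurable; apply/seteqP; split=> x; rewrite /xsection/= inE/= cats0.
Qed.

(** The open interval between the s-th coordinates of two points of w(S) lies
    in the shadow, so the measure of the shadow bounds their distance. *)
Lemma diam_le_shadow w :
  (diam (word_map f w @` S) <=
   \sum_(s < k) lebesgue_measure (shadow S f s w))%E.
Proof.
apply: ge_ereal_sup => y [->|].
  by apply: sume_ge0 => s _; exact: measure_ge0.
move=> [_ [u Su <-] [_ [v Sv <-] <-]].
apply: (@le_trans _ _ (\sum_(s < k)
    `|word_map f w u ord0 s - word_map f w v ord0 s|%:E)%E).
  by rewrite sumEFin lee_fin euclidean_dist_le_sum.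
apply: lee_sum => s _.
wlog uv : u v Su Sv / word_map f w u ord0 s <= word_map f w v ord0 s.
  move=> H.
  case: (leP (word_map f w u ord0 s) (word_map f w v ord0 s)) => [|/ltW].
    exact: H.
  by rewrite distrC; exact: H.
move: uv; rewrite le_eqVlt => /predU1P[->|uv].
  by rewrite subrr normr0; exact: measure_ge0.
apply: (@le_trans _ _ (lebesgue_measure
    [set` `]word_map f w u ord0 s, word_map f w v ord0 s[])).
  by rewrite lebesgue_measure_itv/= lte_fin uv distrC gtr0_norm ?subr_gt0.
apply: le_measure; rewrite ?inE//; first exact: measurable_shadow_word.
by move=> x /=; rewrite in_itv/= => /andP[ux xv]; exists u, v; split.
Qed.

End diameter.

(** * Expected length of the shadows *)

Section expected_length.
Context (R : realType) (k : nat) (dE : measure_display) (E : measurableType dE).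
Context (nu : probability E R) (dO : measure_display).
Context (Omega : measurableType dO) (P : probability Omega R).
Context (X : nat -> {RV P >-> E}).
Context (J : {set 'I_k}) (S : set 'rV[R]_k) (f : E -> 'rV[R]_k -> 'rV[R]_k).
Hypothesis fJ : J_monotone_iteration J S f.
Hypothesis Xiid : iid nu X.

(* The region of pairs (w, x) whose measure Tonelli computes in both orders. *)
Let joint s n : set (Omega * R) :=
  [set q | shadow S f s (past X n q.1) q.2].

Let measurable_joint s n : measurable (joint s n).
Proof.
have mpast : measurable_fun setT (fun q : Omega * R => (past X n q.1, q.2)).
  apply: measurable_fun_pair => //.
  by apply: (@measurableT_comp _ _ _ _ _ _ (past X n) _ fst);
    [exact: measurable_past|].
have := mpast measurableT _ (measurable_shadow fJ s [::] (n:=n)).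
by rewrite setTI.
Qed.

Let xsection_joint s n w : xsection (joint s n) w = shadow S f s (past X n w).
Proof. by apply/seteqP; split=> x; rewrite /xsection/= inE. Qed.

Let ysection_joint s n x : ysection (joint s n) x =
  past X n @^-1` [set t : n.-tuple E | shadow S f s ([::] ++ t) x].
Proof. by apply/seteqP; split=> w; rewrite /ysection/= inE. Qed.

Lemma measurable_shadow_length s n :
  measurable_fun setT (fun w => lebesgue_measure (shadow S f s (past X n w))).
Proof.
apply: (eq_measurable_fun (lebesgue_measure \o xsection (joint s n))).
  by move=> w _; rewrite /= xsection_joint.
by apply: measurable_fun_xsection; exact: measurable_joint.
Qed.

Lemma expected_shadow_length s n :
  (\int[P]_w lebesgue_measure (shadow S f s (past X n w)) =
   \int[lebesgue_measure]_x
     power_probability nu n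
       [set t : n.-tuple E | shadow S f s ([::] ++ t) x])%E.
Proof.
have mj := measurable_joint s n.
apply: etrans (etrans _ (indic_fubini_tonelli P lebesgue_measure mj)) _.
  apply: eq_integral => w _.
  have := congr1 (@^~ w) (indic_fubini_tonelli_FE lebesgue_measure mj).
  by rewrite /= xsection_joint => ->.
apply: eq_integral => x _.
have := congr1 (@^~ x) (indic_fubini_tonelli_GE P mj).
rewrite /= ysection_joint => GE; apply: etrans GE _.
by apply: (past_law Xiid); exact: (measurable_shadow_tuple fJ).
Qed.

(** Outside [-M, M] the integrand vanishes from time N0 on: words of length
    n >= N0 have shadows inside those of their prefixes of length N0, which have
    the same law as the words formed by X_{N0-1}, ..., X_0. *)
Lemma expected_shadow_length_le s N0 (M : R) m (lam : R) :
  0 < M -> 0 <= lam ->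
  {ae P, forall w, shadow S f s (past X N0 w) `<=` [set` `[- M, M]]} ->
  (forall c x, (power_probability nu m
      [set t : m.-tuple E | shadow S f s (c ++ t) x] <= lam%:E)%E) ->
  forall n, (N0 <= n)%N ->
  (\int[P]_w lebesgue_measure (shadow S f s (past X n w)) <=
   (lam ^+ (n %/ m) * (2 * M))%:E)%E.
Proof.
move=> M0 lam0 Nb contr n Nn.
pose p n x :=
  power_probability nu n [set t : n.-tuple E | shadow S f s ([::] ++ t) x].
have mQ x c l : measurable [set t : l.-tuple E | shadow S f s (c ++ t) x].
  exact: (measurable_shadow_tuple fJ).
have hQ x c w : shadow S f s (c ++ w) x -> shadow S f s c x.
  exact: (shadow_cat fJ).
have p0 x : ~ [set` `[- M, M]] x -> p n x = 0%E.
  move=> xM; apply/eqP; rewrite eq_le measure_ge0 andbT.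
  apply: (le_trans (hereditary_nonincreasing nu (mQ x) (hQ x) Nn)).
  rewrite -(past_law Xiid)// -ysection_joint.
  rewrite (@measure_negligible _ _ _ P)//.
    by apply: measurable_ysection; exact: measurable_joint.
  apply: negligibleS Nb => w /=; rewrite ysection_joint => wx H.
  exact/xM/H.
have mp : measurable_fun setT (p n).
  apply: (eq_measurable_fun (P \o ysection (joint s n))).
    by move=> x _; rewrite /= ysection_joint (past_law Xiid).
  by apply: measurable_fun_ysection; exact: measurable_joint.
rewrite expected_shadow_length.
apply: (@le_trans _ _ (\int[lebesgue_measure]_x
    ((lam ^+ (n %/ m))%:E * (\1_[set` `[- M, M]] x)%:E))%E).
  apply: ge0_le_integral => //.
  - by apply: measurable_funeM; apply/measurable_EFinP; exact: measurable_indic.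
  - move=> x _; have [xM|xM] := pselect ([set` `[- M, M]] x).
      rewrite indicE mem_set// mule1.
      by apply: (hereditary_geometric (mQ x) (hQ x)) => // c; exact: contr.
    by rewrite -/(p n x) p0// mule_ge0// lee_fin exprn_ge0.
rewrite ge0_integralZl_EFin ?exprn_ge0//; last first.
  by apply/measurable_EFinP; exact: measurable_indic.
have IM : lebesgue_measure [set` `[- M, M]] = (2 * M)%:E.
  rewrite lebesgue_measure_itv/= lte_fin gtrN//.
  by rewrite -EFinB opprK -mulr2n mulr_natl.
by rewrite integral_indic// setIT EFinM -IM; exact: lexx.
Qed.

End expected_length.

(** * Exponential synchronization *)

Theorem theorem2 (R : realType) (k : nat)
    (dE : measure_display) (E : measurableType dE) (nu : probability E R)
    (dO : measure_display) (Omega : measurableType dO)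
    (P : probability Omega R)
    (X : nat -> {RV P >-> E})
    (J : {set 'I_k}) (S : set 'rV[R]_k)
    (f : E -> 'rV[R]_k -> 'rV[R]_k)
    (B0 : set 'rV[R]_k) (N0 : nat) :
  iid nu X ->
  J_monotone_iteration J S f ->
  connected S ->
  J_splitting nu J S f ->
  bounded_set B0 ->
  {ae P, forall w, random_iterate f (X ^~ w) N0 @` S `<=` B0} ->
  exists (r : R) (m0 : nat) (c : Omega -> R),
    [/\ r < 1, (1 <= m0)%N,
        forall w, 0 <= c w,
        P.-integrable [set: Omega] (EFin \o c) &
        {ae P, forall w, forall n : nat, (m0 <= n)%N ->
          (diam (random_iterate f (X ^~ w) n @` S) <= (c w * r ^+ n)%:E)%E}].
Proof.
move=> Xiid fJ _ Jsplit bB0 fB0.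
have [m [lam [m0 lam0 lam1 contr]]] := splitting_contraction fJ Jsplit.
have [r [r0 r1 rate]] := geometric_rate m0 lam0 lam1.
have [M M0 BM] : exists2 M : R, 0 < M & forall y, B0 y -> `|y| <= M.
  have [M [_ HM]] := bB0.
  exists (`|M| + 1); first by rewrite ltr_wpDl.
  by apply: HM; rewrite (le_lt_trans (ler_norm _))// ltrDl.
have Nb s : {ae P, forall w, shadow S f s (past X N0 w) `<=` [set` `[- M, M]]}.
  apply: filterS fB0 => w fB x [u [v [Su Sv ux xv]]].
  have coord y : S y -> `|word_map f (past X N0 w) y ord0 s| <= M.
    move=> Sy; have yM : `|word_map f (past X N0 w) y| <= M.
      by apply/BM/fB; exists y => //; exact: random_iterate_past.
    apply: le_trans yM; rewrite /Num.Def.normr/= mx_normrE.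
    exact: (le_bigmax _
      (fun ij => `|word_map f (past X N0 w) y ij.1 ij.2|) (ord0, s)).
  rewrite /= in_itv/=; apply/andP; split.
    apply: le_trans (ltW ux); have := coord u Su.
    by rewrite ler_norml => /andP[].
  apply: (le_trans (ltW xv)); have := coord v Sv.
  by rewrite ler_norml => /andP[].
(* Truncating before N0, where no expectation bound is available, makes the
   bound uniform in n. *)
pose L n w : \bar R := if (N0 <= n)%N
  then (\sum_(s < k) lebesgue_measure (shadow S f s (past X n w)))%E else 0%E.
pose K := k%:R * (lam^-1 * (2 * M)).
have K0 : 0 <= K by rewrite !mulr_ge0// ?invr_ge0 ltW.
have L0 n w : (0 <= L n w)%E.
  by rewrite /L; case: ifP => // _; apply: sume_ge0 => s _; exact: measure_ge0.
have mL n : measurable_fun setT (L n).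
  rewrite /L; case: (N0 <= n)%N => //.
  by apply: emeasurable_sum => s; exact: (measurable_shadow_length X fJ).
have IL n : (\int[P]_w L n w <= (K * (r ^+ n * r ^+ n))%:E)%E.
  rewrite /L; case: (leqP N0 n) => [Nn|_]; last first.
    by rewrite integral0 lee_fin mulr_ge0// mulr_ge0// exprn_ge0// ltW.
  rewrite ge0_integral_sum//; last first.
    by move=> s; exact: (measurable_shadow_length X fJ).
  apply: (@le_trans _ _ (\sum_(s < k)
      (lam^-1 * (2 * M) * (r ^+ n * r ^+ n))%:E)%E).
    apply: lee_sum => s _.
    apply: (le_trans (expected_shadow_length_le fJ Xiid M0 (ltW lam0)
      (Nb s) (contr s) Nn)).
    rewrite lee_fin mulrAC ler_wpM2r//.
    by rewrite mulr_ge0// ltW.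
  by rewrite sumEFin sumr_const card_ord lee_fin -(mulr_natl _ k) mulrA.
have [c [c0 ic Lc]] := ae_geometric_bound K0 r0 r1 L0 mL IL.
exists r, (maxn 1 N0), c; split=> //; first by rewrite leq_maxl.
apply: filterS Lc => w Lc n; rewrite geq_max => /andP[_ Nn].
have -> : random_iterate f (X ^~ w) n @` S = word_map f (past X n w) @` S.
  by apply: eq_imagel => y _; exact: random_iterate_past.
apply: le_trans (diam_le_shadow fJ (past X n w)) _.
by have := Lc n; rewrite /L Nn.
Qed.
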